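(* Let $\{|\psi_i\rangle\}$ be any finite set of vectors in a $d$-dimensional (complex) Hilbert space, and let $\mathcal{G}$ be the orthogonality graph induced by this set. Then $$q(\mathcal{G})\le\left(1-\frac1d\right)^{d-1}-\frac{1}{2^{d-1}}.$$
   Context: Orthogonality graph: the vertices are the rank-1 projectors $|\psi_i\rangle\langle\psi_i|$ onto the (unit) vectors $|\psi_i\rangle$ of the set, and two vertices identified with $|\psi_1\rangle,|\psi_2\rangle$ are joined by an edge iff $\langle\psi_1|\psi_2\rangle=0$. For a graph $\mathcal{G}=(V,E)$, a clique is a vertex subset $C\subseteq V$ such that every vertex in $C$ is joined to every other vertex in $C$, and $C$ is inclusion-maximal with this property. The size of a largest clique of $\mathcal{G}$ is denoted $\omega(\mathcal{G})$. A vertex subset $T\subseteq V$ is a maximum-clique hitting-set if $T\cap C\ne\emptyset$ for every clique $C$ with $|C|=\omega(\mathcal{G})$. An independent set is a set of vertices no two of which are joined by an edge. Define $$q_s(\mathcal{G})=\min_{T}\ \min_{A\subseteq T}\ \bigl(|T|-|A|\bigr),$$ where $T$ ranges over the maximum-clique hitting-sets of $\mathcal{G}$ and $A$ ranges over the independent sets of $\mathcal{G}$ contained in $T$, and define $$q(\mathcal{G})=\frac{q_s(\mathcal{G})}{|V(\mathcal{G})|}.$$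
   Formalization: Adds the hypothesis that the largest cliques have size d (the set contains an orthonormal basis); without it the bound fails, e.g. five vectors in dimension 3 whose orthogonality graph is a 5-cycle give q = 1/5 > 7/36. *)

(* Defs.v *)
From HB Require Import structures.
From mathcomp Require Import all_boot all_order all_algebra.
From mathcomp Require Import finmap complex reals.

Set Implicit Arguments.
Unset Strict Implicit.
Unset Printing Implicit Defensive.

Import Order.TTheory GRing.Theory Num.Theory.

Local Open Scope ring_scope.
Local Open Scope fset_scope.
Local Open Scope sesquilinear_scope.

Section Graph.

Variables (V : finType) (e : rel V).
Implicit Types C T A : {set V}.

Definition pairwise_joined C :=
  [forall x in C, forall y in C, (x != y) ==> e x y].

(* Cliques are inclusion-maximal, not merely complete, vertex subsets. *)
Definition is_clique C := maxset pairwise_joined C.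

Definition clique_number : nat := \max_(C : {set V} | is_clique C) #|C|.

Definition max_clique_hitting T :=
  [forall C : {set V},
     is_clique C ==> (#|C| == clique_number) ==> (T :&: C != set0)].

Definition independent A :=
  [forall x in A, forall y in A, (x != y) ==> ~~ e x y].

(* The defaults of the two minima are inert as soon as V is nonempty: the
   inner one is attained at A = set0, the outer one at T = setT. For empty V
   there is no hitting set at all, and q_s is 0 by convention. *)
Definition q_s : nat :=
  \big[minn/#|V|]_(T : {set V} | max_clique_hitting T)
    \big[minn/#|T|]_(A : {set V} | (A \subset T) && independent A)
      (#|T| - #|A|)%N.

Definition q (R : realType) : R := q_s%:R / #|V|%:R.

End Graph.

Section OrthogonalityGraph.

Variables (R : realType) (d : nat).

(* Vectors are rows and matrices act on the right, so |psi><psi| is the matrix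
   of phi |-> dotmx phi psi *: psi. *)
Definition projector (psi : 'rV[R[i]]_d) : 'M[R[i]]_d := psi ^t* *m psi.

Variable S : {fset 'rV[R[i]]_d}.

(* Vectors of S that differ by a phase give one and the same vertex. *)
Definition projectors : {fset 'M[R[i]]_d} := [fset projector psi | psi in S].

(* Orthogonality is insensitive to phases, so for unit vectors it does not
   matter which representatives in S are used. *)
Definition orthogonality_graph : rel projectors := fun P Q =>
  [exists psi1 : S, exists psi2 : S,
    [&& fsval P == projector (fsval psi1), fsval Q == projector (fsval psi2)
      & dotmx (fsval psi1) (fsval psi2) == 0]].

End OrthogonalityGraph.

Arguments orthogonality_graph {R d} S.

(* Main.v *)
(** Let phi be a random unit vector and X_v = |<phi, v>|^2. By Parseval every
orthonormal basis contains a v with X_v >= 1/d, and by Bessel two orthogonal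
vectors cannot both have X_v > 1/2; so T = {v | X_v >= 1/d} is a hitting set,
A = {v | X_v > 1/2} is independent, and |T| - |A| counts the v whose X_v lies in
the window [1/d, 1/2]. For uniform phi, P(X_v >= t) = (1 - t)^(d-1), so the
expected number of such v is |V| ((1 - 1/d)^(d-1) - 1/2^(d-1)).

No measure on the sphere is needed: a positive linear functional on the
polynomials in the X_v suffices. It is determined by the moments
k! (d-1)! / (k+d-1)! of X_v, and its positivity follows by induction on the
dimension, writing phi = (sqrt s z, sqrt (1 - s) phi') with z averaged over roots
of unity and s integrated over [0, 1] against (d-1) (1 - s)^(d-2). The indicator
of the window is then majorized by Bernstein polynomials. *)

Require Import Defs.
From HB Require Import structures.
From mathcomp Require Import all_boot all_order all_algebra.
From mathcomp Require Import finmap complex reals.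
From mathcomp Require Import boolp polyrcf ring lra zify.

Import Order.TTheory GRing.Theory Num.Theory.
Local Open Scope ring_scope.
Local Open Scope sesquilinear_scope.

(** * Moment functionals on polynomials *)

(** Integration of [p] against a would-be measure with moment sequence [m]; positivity has to be
    proved separately. *)
Definition moment {R : numFieldType} (m : nat -> R) (p : {poly R}) : R :=
  \sum_(i < size p) p`_i * m i.

Lemma momentE (R : numFieldType) (m : nat -> R) (p : {poly R}) n :
  (size p <= n)%N -> moment m p = \sum_(i < n) p`_i * m i.
Proof.
move=> le_pn; rewrite /moment (big_ord_widen n (fun i => p`_i * m i)) //.
rewrite big_mkcond; apply: eq_bigr => i _; case: ltnP => // le_pi.
by rewrite nth_default // mul0r.
Qed.

Lemma moment_is_scalar (R : numFieldType) (m : nat -> R) :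
  scalar (moment m).
Proof.
move=> c p q; set n := maxn (size p) (size q).
rewrite (@momentE _ _ p n) ?leq_maxl // (@momentE _ _ q n) ?leq_maxr //.
rewrite (@momentE _ _ (c *: p + q) n); last first.
  by rewrite (leq_trans (size_polyD _ _)) // geq_max leq_max size_scale_leq leq_maxr.
rewrite mulr_sumr -big_split; apply: eq_bigr => i _ /=.
by rewrite coefD coefZ mulrDl mulrA.
Qed.

HB.instance Definition _ (R : numFieldType) (m : nat -> R) :=
  GRing.isLinear.Build R {poly R} R *%R (moment m) (moment_is_scalar R m).

Lemma momentXn (R : numFieldType) (m : nat -> R) n : moment m 'X^n = m n.
Proof.
rewrite /moment size_polyXn (bigD1 ord_max) //= coefXn eqxx mul1r big1 ?addr0 //.
move=> i /negPf; rewrite -val_eqE /= coefXn => ->; by rewrite mul0r.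
Qed.

Lemma moment_sum_coef (R : numFieldType) (m : nat -> R) (I : Type) (r : seq I)
    (c : I -> R) (p : I -> {poly R}) :
  moment m (\sum_(i <- r) c i *: p i) = \sum_(i <- r) c i * moment m (p i).
Proof. by rewrite raddf_sum; apply: eq_bigr => i _ /=; rewrite linearZ. Qed.

(* The moments of Lebesgue measure on [0, 1]. *)
Definition harmonic (R : numFieldType) (i : nat) : R := i.+1%:R^-1.

(** The moment is the increment over [0, 1] of an antiderivative of [p], which is nondecreasing
    there. *)
Lemma moment_harmonic_ge0 (R : rcfType) (p : {poly R}) :
  (forall s, 0 <= s <= 1 -> 0 <= p.[s]) -> 0 <= moment (harmonic R) p.
Proof.
(* The antiderivative vanishing at 0: as the inverse of 0 is 0, the spurious coefficient at [i = 0]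
   disappears. *)
move=> p_ge0; pose q := \poly_(i < (size p).+1) (p`_i.-1 * i%:R^-1).
have dq : q^`() = p.
  apply/polyP=> i; rewrite coef_deriv coef_poly ltnS /=.
  case: ltnP => [_|/leq_sizeP -> //]; last by rewrite mul0rn.
  by rewrite -(mulr_natr (_ * _)) mulfVK // pnatr_eq0.
have q0 : q.[0] = 0 by rewrite horner_coef0 coef_poly /= invr0 mulr0.
have -> : moment (harmonic R) p = q.[1].
  rewrite horner_poly big_ord_recl /= invr0 mulr0 mul0r add0r.
  by apply: eq_bigr => i _; rewrite expr1n mulr1.
rewrite -q0; apply: (@ler_hornerW R 0 1 q) => //; rewrite ?in_itv /= ?ler01 ?lexx //.
by move=> x; rewrite in_itv /= dq => /andP[x0 x1]; rewrite p_ge0 // !ltW.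
Qed.

(** Euler's beta integral; the induction on [b] splits off one factor [1 - 'X], for all [a] at
    once. *)
Lemma moment_harmonic_beta (R : numFieldType) a b :
  moment (harmonic R) ('X^a * (1 - 'X) ^+ b)
  = (a`! * b`!)%:R / (a + b).+1`!%:R.
Proof.
elim: b a => [|b IH] a.
  rewrite expr0 mulr1 momentXn addn0 fact0 muln1 factS natrM invfM mulrCA.
  by rewrite mulfV ?mulr1 // pnatr_eq0 -lt0n fact_gt0.
have -> : ('X^a : {poly R}) * (1 - 'X) ^+ b.+1
    = 'X^a * (1 - 'X) ^+ b - 'X^(a.+1) * (1 - 'X) ^+ b.
  by rewrite !exprS; ring.
rewrite raddfB /= !IH addSn addnS !factS !natrM.
have f0 : (a + b)`!%:R != 0 :> R by rewrite pnatr_eq0 -lt0n fact_gt0.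
have e1 : a.+1%:R = (a + b).+2%:R - b.+1%:R :> R.
  by rewrite -!natr1 natrD; ring.
by rewrite e1; field; rewrite f0 -!natrD nat1r !pnatr_eq0.
Qed.

(** * Averages over phases *)

Lemma root_of_unity_sum (C : numClosedFieldType) r :
  exists2 z : C, `|z| = 1 &
    forall j, (0 < j < 2 ^ r)%N -> \sum_(t < 2 ^ r) (z ^+ t) ^+ j = 0.
Proof.
case: r => [|r]; first by exists 1; [rewrite normr1|case].
(* Taking square roots repeatedly from -1 is what makes the number of phases a power of 2. *)
have [z zr] : exists z : C, z ^+ (2 ^ r) = -1.
  elim: r => [|r [z zr]]; first by exists (-1); rewrite expr1.
  by exists (sqrtC z); rewrite expnS exprM sqrtCK.
have zn : z ^+ (2 ^ r.+1) = 1 by rewrite expnSr exprM zr sqrrN expr1n.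
exists z.
  apply/eqP; rewrite -(@pexpr_eq1 _ _ (2 ^ r.+1)) ?expn_gt0 //.
  by rewrite -normrX zn normr1.
move=> j /andP[j0 jr].
have zj : z ^+ j != 1.
  (* The order of [z] is a power of 2; if it properly divided [2 ^ r.+1], then [z ^+ (2 ^ r)] would
     be 1 instead of -1. *)
  have [|m prim_z] := prim_order_exists _ zn; first by rewrite expn_gt0.
  rewrite -(prim_order_dvd prim_z) => /dvdn_pfactor -/(_ isT) [t le_tr mE].
  move: le_tr; rewrite leq_eqVlt ltnS => /orP[/eqP tE|le_tr].
    by rewrite mE tE; apply: contraTN jr => /dvdn_leq -/(_ j0); rewrite -leqNgt.
  have : z ^+ (2 ^ r) = 1.
    by apply/eqP; rewrite -(prim_order_dvd prim_z) mE dvdn_exp2l.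
  by move=> /eqP; rewrite zr -subr_eq0 -opprD oppr_eq0 (pnatr_eq0 C 2).
apply/eqP; rewrite -(mulrI_eq0 _ (lregP (_ : z ^+ j - 1 != 0))) ?subr_eq0 //.
under eq_bigr => t _ do rewrite exprAC.
by rewrite -subrX1 exprAC zn expr1n subrr.
Qed.

(** The squared modulus as an element of [R], where real polynomials can be evaluated. *)
Definition sqn {R : rcfType} (z : R[i]) : R := complex.Re z ^+ 2 + complex.Im z ^+ 2.

Lemma sqnE (R : rcfType) (z : R[i]) : (sqn z)%:C%C = z * z^*.
Proof. by rewrite add_Re2_Im2 normCK. Qed.

Lemma sqn_ge0 (R : rcfType) (z : R[i]) : 0 <= sqn z.
Proof. by rewrite addr_ge0 ?sqr_ge0. Qed.

Lemma sqnM (R : rcfType) : {morph @sqn R : x y / x * y}.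
Proof. by move=> x y; apply: complexI; rewrite rmorphM /= !sqnE rmorphM mulrACA. Qed.

Lemma sqn_real (R : rcfType) (x : R) : sqn x%:C%C = x ^+ 2.
Proof. by rewrite /sqn /= expr0n addr0. Qed.

(** After expanding both factors, products of unequal powers of [z ^+ t] sum to 0, since the
    exponents differ by less than [2 ^ r]; the diagonal carries the squared binomials. *)
Lemma phase_average_conj (C : numClosedFieldType) r (z y w : C) k :
  `|z| = 1 -> (forall j, (0 < j < 2 ^ r)%N -> \sum_(t < 2 ^ r) (z ^+ t) ^+ j = 0) ->
  (k < 2 ^ r)%N ->
  \sum_(t < 2 ^ r) ((y + w * z ^+ t) * (y + w * z ^+ t)^*) ^+ k
  = (2 ^ r)%:R *
    \sum_(j < k.+1) 'C(k, j)%:R ^+ 2 * (y * y^*) ^+ (k - j) * (w * w^*) ^+ j.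
Proof.
move=> z1 zsum le_k.
pose a (j : 'I_k.+1) := y ^+ (k - j) * w ^+ j *+ 'C(k, j).
have z1' t : z ^+ t * (z ^+ t)^* = 1 by rewrite -normCK normrX z1 !expr1n.
have key (i j : 'I_k.+1) :
    \sum_(t < 2 ^ r) (z ^+ t) ^+ i * ((z ^+ t)^*) ^+ j = ((i == j) * 2 ^ r)%:R.
  have gtE (i' j' : 'I_k.+1) : (j' < i')%N ->
      \sum_(t < 2 ^ r) (z ^+ t) ^+ i' * ((z ^+ t)^*) ^+ j' = 0.
    move=> lt_ij; rewrite -[RHS](zsum (i' - j')%N); last first.
      rewrite subn_gt0 lt_ij (leq_ltn_trans (leq_subr _ _)) //.
      by rewrite (leq_trans (ltn_ord i')).
    apply: eq_bigr => t _.
    by rewrite -{1}(subnK (ltnW lt_ij)) exprD -mulrA -exprMn z1' expr1n mulr1.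
  case: (ltngtP i j) => [lt_ij|lt_ji|/val_inj <-].
  - rewrite -val_eqE (ltn_eqF lt_ij) mul0n -[RHS]conjC0 -[in RHS](gtE _ _ lt_ij).
    rewrite rmorph_sum; apply: eq_bigr => t _ /=.
    by rewrite rmorphM /= !rmorphXn /= conjCK mulrC.
  - by rewrite -val_eqE (gtn_eqF lt_ji) mul0n; exact: gtE.
  - rewrite eqxx mul1n; under eq_bigr => t _ do rewrite -exprMn z1' expr1n.
    by rewrite sumr_const card_ord.
transitivity (\sum_(t < 2 ^ r) \sum_(i < k.+1) \sum_(j < k.+1)
    (a i * (a j)^*) * ((z ^+ t) ^+ i * ((z ^+ t)^*) ^+ j)).
  apply: eq_bigr => t _; rewrite exprMn -rmorphXn exprDn /=.
  rewrite rmorph_sum mulr_suml; apply: eq_bigr => i _; rewrite mulr_sumr.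
  apply: eq_bigr => j _; rewrite /a !exprMn !rmorphMn /= !rmorphM /= !rmorphXn /=.
  rewrite -!(mulr_natr (_ * _)); ring.
rewrite exchange_big mulr_sumr; apply: eq_bigr => i _ /=; rewrite exchange_big /=.
under eq_bigr => j _ do rewrite -mulr_sumr key.
rewrite (bigD1 i) //= big1 ?addr0; last first.
  by move=> j /negPf ij; rewrite eq_sym ij mul0n mulr0.
rewrite eqxx mul1n mulrC; congr (_ * _).
rewrite /a rmorphMn /= rmorphM /= !rmorphXn /= -!(mulr_natr (_ * _)) !exprMn; ring.
Qed.

Lemma phase_average (R : rcfType) r (z : R[i]) (y w : R[i]) k :
  `|z| = 1 -> (forall j, (0 < j < 2 ^ r)%N -> \sum_(t < 2 ^ r) (z ^+ t) ^+ j = 0) ->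
  (k < 2 ^ r)%N ->
  \sum_(t < 2 ^ r) sqn (y + w * z ^+ t) ^+ k
  = (2 ^ r)%:R * \sum_(j < k.+1) 'C(k, j)%:R ^+ 2 * sqn y ^+ (k - j) * sqn w ^+ j.
Proof.
move=> z1 zsum le_k; apply: complexI.
rewrite rmorphM !rmorph_sum /= rmorph_nat.
under eq_bigr => t _ do rewrite rmorphXn /= sqnE.
under [in RHS]eq_bigr => j _ do
  rewrite rmorphM /= rmorphM /= !rmorphXn /= !sqnE rmorph_nat.
exact: phase_average_conj.
Qed.

(** * Positivity of the spherical moments *)

(* The [k]-th moment of [|<phi, v>|^2] for unit [v] and [phi] uniform on the unit
   sphere of C^(n+1). *)
Definition sphere_moment (R : numFieldType) (n k : nat) : R :=
  (n`! * k`!)%:R / (n + k)`!%:R.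

Lemma natr_fact_neq0 (R : numFieldType) n : n`!%:R != 0 :> R.
Proof. by rewrite pnatr_eq0 -lt0n fact_gt0. Qed.

Lemma natr_bin (R : numFieldType) j l :
  'C(l + j, j)%:R = (l + j)`!%:R / (j`!%:R * l`!%:R) :> R.
Proof.
rewrite -(@bin_fact (l + j) j) ?leq_addl // addnK !natrM mulfK //.
by rewrite mulf_neq0 ?natr_fact_neq0.
Qed.

(** One term of the passage from C^(n+1) to C^(n+2): the squared binomial comes from the phases, the
    middle factor from integrating over s with density (n+1)(1-s)^n. The binomial left on the right
    serves to expand the power of the squared norm. *)
Lemma sphere_moment_step (R : numFieldType) n l j :
  'C(l + j, j)%:R ^+ 2
    * (n.+1%:R * ((j`! * (l + n)`!)%:R / (j + (l + n)).+1`!%:R))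
    * sphere_moment R n l
  = 'C(l + j, j)%:R * sphere_moment R n.+1 (l + j).
Proof.
rewrite /sphere_moment natr_bin (addnC n l) addSn.
rewrite (_ : (n + (l + j)) = (j + (l + n)))%N; last by lia.
rewrite !factS !natrM.
have := natr_fact_neq0 R j; have := natr_fact_neq0 R l.
have := natr_fact_neq0 R (l + n); have := natr_fact_neq0 R (j + (l + n)).
have := natr_fact_neq0 R (l + j); have := natr_fact_neq0 R n.
have : (j + (l + n)).+1%:R != 0 :> R by rewrite pnatr_eq0.
generalize (n`!) (l`!) (j`!) (l + j)`! (l + n)`! (j + (l + n))`!.
move: ((j + (l + n)).+1) (n.+1) => a1 a2 *; field.
by do ?[apply/andP; split].
Qed.

(* The vectors [c x] need not be unit: the induction drops their first coordinate. *)
Lemma sphere_moment_ge0 (R : rcfType) n (V : finType) (P : V -> {poly R})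
    (c : V -> 'I_n.+1 -> R[i]) :
  (forall phi : 'I_n.+1 -> R[i], \sum_i sqn (phi i) = 1 ->
     0 <= \sum_x (P x).[sqn (\sum_i phi i * c x i)]) ->
  0 <= \sum_x moment (fun k => sphere_moment R n k * (\sum_i sqn (c x i)) ^+ k) (P x).
Proof.
elim: n P c => [|n IH] P c P_ge0.
  (* In C^1 all moments equal 1, so the functional is evaluation at [phi = 1]. *)
  rewrite (le_trans (P_ge0 (fun=> 1) _)) //.
    by rewrite big_ord_recl big_ord0 sqn_real expr1n addr0.
  apply: ler_sum => x _; rewrite !big_ord_recl !big_ord0 mul1r !addr0.
  rewrite horner_coef le_eqVlt; apply/orP; left; apply/eqP.
  apply: eq_bigr => k _; rewrite /sphere_moment add0n fact0 mul1n.
  by rewrite divff ?mul1r ?natr_fact_neq0.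
pose W x := sqn (c x ord0); pose c' x (i : 'I_n.+1) := c x (lift ord0 i).
pose b (k j : nat) : R := 'C(k, j)%:R ^+ 2 *
  (n.+1%:R * ((j`! * (k - j + n)`!)%:R / (j + (k - j + n)).+1`!%:R)).
(* [P' x] is [P x] averaged over the first coordinate, a polynomial in the squared modulus of the
   pairing with [c' x]. *)
pose P' x : {poly R} := \sum_(k < size (P x))
  (P x)`_k *: \sum_(j < k.+1) (b k j * W x ^+ j) *: 'X^(k - j).
have {IH} := IH P' c'; move/(_ _)/le_trans; apply; last first.
  (* The functional one dimension lower takes on [P'] the value wanted for [P], term by term. *)
  apply: ler_sum => x _; rewrite /P' moment_sum_coef [leRHS]/moment le_eqVlt.
  apply/orP; left; apply/eqP; apply: eq_bigr => k _; congr (_ * _).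
  rewrite moment_sum_coef [\sum_i sqn (c x i)]big_ord_recl addrC exprDn mulr_sumr.
  apply: eq_bigr => -[j /=]; rewrite ltnS => le_jk _; rewrite momentXn /b -/(W x).
  rewrite -mulr_natr.
  have := sphere_moment_step R n (k - j) j; rewrite subnK // => e.
  transitivity ((sphere_moment R n (k - j) * ('C(k, j)%:R ^+ 2 *
    (n.+1%:R * ((j`! * (k - j + n)`!)%:R / ((j + (k - j + n)).+1)`!%:R)))) *
    (W x ^+ j * (\sum_i sqn (c' x i)) ^+ (k - j))).
    by ring.
  by rewrite (mulrC (sphere_moment _ _ _)) e; rewrite /c'; ring.
move=> phi phi1; pose Y x := sqn (\sum_i phi i * c' x i).
(* The phase average as a polynomial in s: its values on [0, 1] are averages of sums of [P] at unit
   vectors, and its integral against (n+1)(1-s)^n is the sum of the [P' x] at [phi]. *)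
pose Q : {poly R} := \sum_x \sum_(k < size (P x)) (P x)`_k *:
  \sum_(j < k.+1) ('C(k, j)%:R ^+ 2 * Y x ^+ (k - j) * W x ^+ j) *:
    ('X^j * (1 - 'X) ^+ (k - j)).
have Q_ge0 s : 0 <= s <= 1 -> 0 <= Q.[s].
  (* With this [r], [2 ^ r] exceeds every degree occurring in [P], as the phase average requires. *)
  move=> /andP[s0 s1]; pose r := (\sum_x size (P x))%N.
  have [z z1 zsum] := root_of_unity_sum R[i] r.
  pose phi' t (i : 'I_n.+2) := if unlift ord0 i is Some j
    then (Num.sqrt (1 - s))%:C%C * phi j else (Num.sqrt s)%:C%C * z ^+ t.
  have sqnz t : sqn (z ^+ t) = 1.
    by apply: complexI; rewrite sqnE -normCK normrX z1 !expr1n.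
  have phi'1 t : \sum_i sqn (phi' t i) = 1.
    rewrite big_ord_recl /phi' unlift_none sqnM sqn_real sqr_sqrtr // sqnz mulr1.
    under eq_bigr => i _ do rewrite liftK sqnM sqn_real sqr_sqrtr ?subr_ge0 //.
    by rewrite -mulr_sumr phi1 mulr1 addrC subrK.
  have sumE x t : \sum_i phi' t i * c x i
      = (Num.sqrt (1 - s))%:C%C * (\sum_i phi i * c' x i)
        + ((Num.sqrt s)%:C%C * c x ord0) * z ^+ t.
    rewrite big_ord_recl /phi' unlift_none addrC mulrAC; congr (_ + _).
    by rewrite mulr_sumr; apply: eq_bigr => i _; rewrite liftK mulrA.
  have: 0 <= \sum_(t < 2 ^ r) \sum_x (P x).[sqn (\sum_i phi' t i * c x i)].
    by apply: sumr_ge0 => t _; exact: P_ge0.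
  rewrite exchange_big /=.
  rewrite (_ : \sum_x _ = (2 ^ r)%:R * Q.[s]) ?pmulr_rge0 ?ltr0n ?expn_gt0 //.
  rewrite /Q horner_sum mulr_sumr; apply: eq_bigr => x _.
  rewrite horner_sum mulr_sumr.
  under eq_bigr => t _ do rewrite horner_coef.
  rewrite exchange_big /=; apply: eq_bigr => k _; rewrite -mulr_sumr.
  under [X in _ * X = _]eq_bigr => t _ do rewrite sumE.
  rewrite phase_average //; last first.
    rewrite (leq_ltn_trans _ (ltn_expl r _)) // (leq_trans (ltnW (ltn_ord k))) //.
    by rewrite /r (bigD1 x) //= leq_addr.
  rewrite hornerZ mulrCA; congr (_ * (_ * _)).
  rewrite horner_sum; apply: eq_bigr => j _.
  rewrite !hornerE /= !sqnM !sqn_real !sqr_sqrtr ?subr_ge0 // -/(Y x) -/(W x).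
  by rewrite !exprMn; ring.
have := @moment_harmonic_ge0 R (Q * (n.+1%:R *: (1 - 'X) ^+ n)).
move=> /(_ _)/le_trans; apply.
  move=> s s01; rewrite hornerM mulr_ge0 ?Q_ge0 //.
  rewrite hornerZ mulr_ge0 ?ler0n // !hornerE exprn_ge0 ?subr_ge0 //.
  by case/andP: s01.
rewrite /Q mulr_suml raddf_sum; apply: ler_sum => x _ /=.
rewrite le_eqVlt; apply/orP; left; apply/eqP.
rewrite mulr_suml raddf_sum /= /P' horner_sum; apply: eq_bigr => k _.
rewrite -scalerAl linearZ /= hornerZ; congr (_ * _).
rewrite mulr_suml raddf_sum /= horner_sum; apply: eq_bigr => j _.
rewrite -scalerAl -scalerAr !linearZ /= -[_ * _ * (1 - 'X) ^+ n]mulrA -exprD.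
rewrite moment_harmonic_beta.
by rewrite hornerZ hornerXn -/(Y x) /b; ring.
Qed.

(** * Bernstein polynomials *)

(** A beta integral again: [sphere_moment R n.+1] belongs to the density (n+1)(1-t)^n on [0, 1]. *)
Lemma sphere_moment_beta (R : numFieldType) n a b :
  moment (sphere_moment R n.+1) ('X^a * (1 - 'X) ^+ b)
  = n.+1%:R * (a`! * (b + n)`!)%:R / (a + b + n).+1`!%:R.
Proof.
elim: b a => [|b IH] a.
  rewrite expr0 mulr1 momentXn /sphere_moment addn0 add0n factS addSn (addnC n).
  by rewrite !natrM; ring.
have -> : ('X^a : {poly R}) * (1 - 'X) ^+ b.+1
    = 'X^a * (1 - 'X) ^+ b - 'X^(a.+1) * (1 - 'X) ^+ b.
  by rewrite !exprS; ring.
rewrite raddfB /= !IH addSn addnS !addSn !factS !natrM.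
have f0 : (a + b + n)`!%:R != 0 :> R by rewrite pnatr_eq0 -lt0n fact_gt0.
have e1 : a.+1%:R = (a + b + n).+2%:R - (b + n).+1%:R :> R.
  by rewrite -!natr1 !natrD; ring.
by rewrite e1; field; rewrite f0 -!natrD nat1r !pnatr_eq0.
Qed.

Definition bernstein (R : numFieldType) m k : {poly R} :=
  'C(m, k)%:R *: ('X^k * (1 - 'X) ^+ (m - k)).

Lemma horner_bernstein (R : numFieldType) m k (x : R) :
  (bernstein R m k).[x] = 'C(m, k)%:R * (x ^+ k * (1 - x) ^+ (m - k)).
Proof. by rewrite /bernstein !hornerE. Qed.

Lemma bernstein_ge0 (R : numFieldType) m k (x : R) :
  0 <= x <= 1 -> 0 <= (bernstein R m k).[x].
Proof.
move=> /andP[x0 x1]; rewrite horner_bernstein.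
by rewrite !mulr_ge0 ?ler0n ?exprn_ge0 ?subr_ge0.
Qed.

Lemma bernstein_sum1 (R : numFieldType) m (x : R) :
  \sum_(k < m.+1) (bernstein R m k).[x] = 1.
Proof.
rewrite -[RHS](expr1n _ m) -[in RHS](subrK x 1) exprDn.
by apply: eq_bigr => k _; rewrite horner_bernstein -mulr_natr; ring.
Qed.

(** The mean of [g] under a binomial law with [m.+1] trials, conditioned on the outcome of one
    trial. *)
Lemma bernstein_sumS (R : numFieldType) m (x : R) (g : nat -> R) :
  \sum_(k < m.+2) g k * (bernstein R m.+1 k).[x]
  = x * (\sum_(k < m.+1) g k.+1 * (bernstein R m k).[x])
    + (1 - x) * (\sum_(k < m.+1) g k * (bernstein R m k).[x]).
Proof.
under eq_bigr => k _ do rewrite horner_bernstein.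
under [in RHS]eq_bigr => k _ do rewrite horner_bernstein.
under [X in _ = _ + _ * X]eq_bigr => k _ do rewrite horner_bernstein.
rewrite big_ord_recl [X in _ = _ + _ * X]big_ord_recl !bin0 !subn0 !expr0.
rewrite mulrDr addrCA exprS; congr (_ + _); first by ring.
have -> : \sum_(i < m) g (bump 0 i) * ('C(m, bump 0 i)%:R *
    (x ^+ bump 0 i * (1 - x) ^+ (m - bump 0 i)))
  = \sum_(i < m.+1) g i.+1 * ('C(m, i.+1)%:R *
    (x ^+ i.+1 * (1 - x) ^+ (m - i.+1))).
  by rewrite [RHS]big_ord_recr /= bin_small // mul0r mulr0 addr0.
rewrite !mulr_sumr -big_split /=; apply: eq_bigr => -[k /= le_km] _.
rewrite /bump /= add1n binS natrD subSS.
move: le_km; rewrite ltnS leq_eqVlt => /orP[/eqP ->|lt_km].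
  by rewrite bin_small // subnn exprS; ring.
by rewrite -[(m - k)%N]prednK ?subn_gt0 // -subnS !exprS; ring.
Qed.

(** Binomial variance plus squared bias; [c] stays general because a successful trial shifts it by 1
    in the induction. *)
Lemma bernstein_variance (R : numFieldType) m (x c : R) :
  \sum_(k < m.+1) (k%:R - c) ^+ 2 * (bernstein R m k).[x]
  = m%:R * x * (1 - x) + (m%:R * x - c) ^+ 2.
Proof.
elim: m c => [|m IH] c.
  by rewrite big_ord_recl big_ord0 horner_bernstein /= bin0 subn0 !expr0; ring.
have e k : k.+1%:R - c = k%:R - (c - 1) by rewrite -natr1; ring.
rewrite (bernstein_sumS R m x (fun k => (k%:R - c) ^+ 2)) /= IH.
under eq_bigr => k _ do rewrite e.
by rewrite IH -!natr1; ring.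
Qed.

(** Factor by factor in the falling factorials, (N-k-j)/(N-j) is at most (N-k)/N. *)
Lemma bin_ratio_le N k n : (k <= N)%N ->
  ('C(N - k, n) * N ^ n <= 'C(N, n) * (N - k) ^ n)%N.
Proof.
move=> le_kN; rewrite -(leq_pmul2r (fact_gt0 n)).
rewrite mulnAC bin_ffact [leqRHS]mulnAC bin_ffact.
elim: n => [|n IH]; first by rewrite !ffactn0 !expn0.
rewrite !ffactnSr !expnSr.
have le1 : ((N - k - n) * N <= (N - n) * (N - k))%N by nia.
by rewrite mulnACA [leqRHS]mulnACA leq_mul.
Qed.

(** For j < n the denominator m+n-j is at least m+1, so removing [k] costs each factor at most the
    ratio (m+1-k)/(m+1). *)
Lemma bin_ratio_ge m k n : (k <= m.+1)%N ->
  ('C(m + n, n) * (m.+1 - k) ^ n <= 'C(m + n - k, n) * m.+1 ^ n)%N.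
Proof.
move=> le_km; rewrite -(leq_pmul2r (fact_gt0 n)).
rewrite mulnAC bin_ffact [leqRHS]mulnAC bin_ffact.
suff H j : (j <= n)%N ->
    ((m + n) ^_ j * (m.+1 - k) ^ j <= (m + n - k) ^_ j * m.+1 ^ j)%N by exact: H.
elim: j => [|j IH] lt_jn; first by rewrite !ffactn0 !expn0.
rewrite !ffactnSr !expnSr mulnACA [leqRHS]mulnACA.
have le1 : ((m + n - j) * (m.+1 - k) <= (m + n - k - j) * m.+1)%N by nia.
by rewrite leq_mul // IH // ltnW.
Qed.

(** The beta value is C(m+n-k, n) / C(m+n+1, n+1); Pascal's rule splits it into a difference that
    telescopes in [k]. *)
Lemma sphere_moment_bernstein (R : numFieldType) n m k : (k <= m)%N ->
  moment (sphere_moment R n.+1) (bernstein R m k)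
  = 'C(m + n.+1 - k, n.+1)%:R / 'C(m + n.+1, n.+1)%:R
    - 'C(m + n.+1 - k.+1, n.+1)%:R / 'C(m + n.+1, n.+1)%:R.
Proof.
move=> le_km; rewrite linearZ /= sphere_moment_beta -mulrBl.
rewrite addnS subSS subSn; last by rewrite (leq_trans le_km) ?leq_addr.
rewrite binS natrD [X in X - _]addrC addrK subnKC // -(addnBAC n le_km).
have := natr_bin R k (m - k); rewrite subnK // => ->.
rewrite natr_bin -addnS natr_bin addnS !factS !natrM.
have := natr_fact_neq0 R k; have := natr_fact_neq0 R (m - k).
have := natr_fact_neq0 R n; have := natr_fact_neq0 R m.
have := natr_fact_neq0 R (m + n).
have : (m + n).+1%:R != 0 :> R by rewrite pnatr_eq0.
have : n.+1%:R != 0 :> R by rewrite pnatr_eq0.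
move: ((m + n).+1) (n.+1) => a1 a2; generalize (n`!) (m`!) (k`!) (m - k)`! (m + n)`!.
by move=> *; field; do ?[apply/andP; split].
Qed.

(* Chebyshev's inequality makes the Bernstein mass within [h] of the window at
   least [1 - h]; the moments of the selected terms telescope. *)
Lemma bernstein_window (R : realType) n (a b h : R) m :
  0 <= a <= b -> 0 < h -> b + 2 * h <= 1 ->
  n.+2%:R <= m%:R * h -> 1 <= m%:R * h ^+ 3 ->
  exists p : {poly R}, [/\ forall x, 0 <= x <= 1 -> 0 <= p.[x],
    forall x, a <= x <= b -> 1 <= p.[x] &
    moment (sphere_moment R n.+1) p
      <= (1 - a + 2 * h) ^+ n.+1 - (1 - b - 2 * h) ^+ n.+1 + h].
Proof.
move=> /andP[a0 ab] h0 bh mh mh3.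
(* The indices with k/m between a-h and b+h, up to rounding; [Num.truncn] gives 0 when [a < h], and
   [k1] is an exclusive bound. *)
pose k0 := Num.truncn ((a - h) * m%:R); pose k1 := (Num.truncn ((b + h) * m%:R)).+1.
have m0 : 0 < m%:R :> R.
  by rewrite -(pmulr_lgt0 _ (exprn_gt0 3 h0)) (lt_le_trans ltr01).
have k0_gt : (a - h) * m%:R < k0.+1%:R by exact: truncnS_gt.
have k1_le : k1%:R <= (b + h) * m%:R + 1.
  rewrite /k1 -natr1 lerD2r truncn_le; nra.
have le_k01 : (k0 <= k1)%N.
  rewrite leqW // le_truncn //; nra.
have le_k1m : (k1 <= m.+1)%N.
  rewrite ltnS -(ler_nat R); rewrite -natr1 lerD2r in k1_le; nra.
have out k : (k < k0)%N || (k1 <= k)%N -> forall x, a <= x <= b ->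
    (m%:R * h) ^+ 2 <= (k%:R - m%:R * x) ^+ 2.
  move=> kP x /andP[ax xb]; case/orP: kP => [|].
    rewrite truncn_gt_nat -natr1 => kh.
    have : m%:R * h <= m%:R * x - k%:R by nra.
    by move=> ?; rewrite -[leRHS]sqrrN opprB ler_pXn2r // nnegrE; nra.
  rewrite /k1 truncn_lt_nat; last by nra.
  move=> kh; have : m%:R * h <= k%:R - m%:R * x by nra.
  by move=> ?; rewrite ler_pXn2r // nnegrE; nra.
(* The constant [h] pays for the Bernstein mass outside the selected indices. *)
exists (h%:P + \sum_(k < m.+1 | (k0 <= k)%N && (k < k1)%N) bernstein R m k); split.
- move=> x x01; rewrite hornerD hornerC addr_ge0 ?(ltW h0) // horner_sum.
  by apply: sumr_ge0 => k _; exact: bernstein_ge0.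
- move=> x axb; have x01 : 0 <= x <= 1 by move: axb; lra.
  rewrite hornerD hornerC horner_sum -(bernstein_sum1 R m x).
  rewrite [leLHS](bigID (fun k : 'I_m.+1 => (k0 <= k)%N && (k < k1)%N)) /=.
  rewrite addrC lerD2r -[leRHS]mul1r -(@ler_pM2l _ ((m%:R * h) ^+ 2)); last first.
    by rewrite exprn_gt0 // mulr_gt0.
  (* Chebyshev: [(m h)^2] times the outside mass is at most the variance, which is at most [m],
     hence at most [(m h)^2 h] because [m h^3 >= 1]. *)
  apply: (@le_trans _ _ (m%:R * x * (1 - x))); last first.
    by move: x01 => /andP[? ?]; nra.
  rewrite -[leRHS]addr0 -[X in _ <= _ + X](expr0n _ 2).
  rewrite -[X in _ <= _ + X ^+ 2](subrr (m%:R * x)).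
  rewrite -bernstein_variance.
  rewrite [leRHS](bigID (fun k : 'I_m.+1 => (k0 <= k)%N && (k < k1)%N)) /=.
  rewrite ler_wpDl //.
    by apply: sumr_ge0 => k _; rewrite mulr_ge0 ?sqr_ge0 ?bernstein_ge0.
  rewrite mulr_sumr; apply: ler_sum => k; rewrite negb_and -ltnNge -leqNgt => kP.
  by rewrite ler_wpM2r ?bernstein_ge0 // out.
rewrite raddfD /= raddf_sum /= addrC -alg_polyC linearZ /= -(expr0 'X) momentXn.
rewrite /sphere_moment addn0 muln1 divff ?natr_fact_neq0 // mulr1 lerD2r.
pose G k : R := 'C(m + n.+1 - k, n.+1)%:R / 'C(m + n.+1, n.+1)%:R.
have bin_gt0' : 0 < 'C(m + n.+1, n.+1)%:R :> R by rewrite ltr0n bin_gt0 leq_addl.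
have -> : \sum_(k < m.+1 | (k0 <= k)%N && (k < k1)%N)
    moment (sphere_moment R n.+1) (bernstein R m k) = G k0 - G k1.
  rewrite (eq_bigr (fun k : 'I_m.+1 => G k - G k.+1)); last first.
    by move=> k _; rewrite sphere_moment_bernstein // -ltnS.
  rewrite -(big_ord_widen_cond m.+1 (fun k => k0 <= k)%N (fun k => G k - G k.+1)) //.
  transitivity (\sum_(k0 <= k < k1) (G k - G k.+1)); first by rewrite big_geq_mkord.
  rewrite -[RHS]opprB -telescope_sumr // -sumrN.
  by apply: eq_bigr => k _; rewrite opprB.
have le_k0N : (k0 <= m + n.+1)%N.
  by rewrite (leq_trans le_k01) // (leq_trans le_k1m) // -addSnnS leq_addr.
(* In each [2 * h], one [h] is the margin in [k0] or [k1]; the other absorbs rounding and the change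
   of denominator from [m], by [n + 2 <= m h]. *)
apply: lerB.
  have := bin_ratio_le _ _ n.+1 le_k0N; rewrite -(ler_nat R) !natrM !natrX natrB // => H.
  have N0 : 0 < (m + n.+1)%:R :> R by rewrite ltr0n addnS.
  apply: (@le_trans _ _ (((m + n.+1)%:R - k0%:R) ^+ n.+1 / (m + n.+1)%:R ^+ n.+1)).
    rewrite ler_pdivrMr // mulrAC ler_pdivlMr ?exprn_gt0 //.
    by rewrite [leRHS]mulrC.
  rewrite -expr_div_n ler_pXn2r ?nnegrE ?divr_ge0 ?subr_ge0 ?ler_nat ?(ltW N0) //;
    last by lra.
  rewrite ler_pdivrMr // natrD; move: k0_gt mh; rewrite -natr1 -[n.+2%:R]natr1.
  have : 0 <= n.+1%:R :> R by [].
  by nra.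
have := bin_ratio_ge _ _ n.+1 le_k1m; rewrite -(ler_nat R) !natrM !natrX natrB // => H.
apply: (@le_trans _ _ ((m.+1%:R - k1%:R) ^+ n.+1 / m.+1%:R ^+ n.+1)); last first.
  rewrite ler_pdivrMr ?exprn_gt0 // /G mulrAC ler_pdivlMr //.
  by rewrite mulrC.
rewrite -expr_div_n ler_pXn2r ?nnegrE ?divr_ge0 ?subr_ge0 ?ler_nat //; last by lra.
rewrite ler_pdivlMr // -natr1; move: mh; rewrite -natr1.
have : 0 <= n.+1%:R :> R by [].
by nra.
Qed.

(** * Orthonormal vectors *)

(** One Gram-Schmidt step, followed by Pythagoras. *)
Lemma dotmx_residual (C : numClosedFieldType) n (u w : 'rV[C]_n) :
  dotmx u u = 1 ->
  let w' := w - dotmx w u *: u in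
  dotmx w' u = 0 /\ dotmx w w = dotmx w' w' + `|dotmx w u| ^+ 2.
Proof.
move=> uu w'; have E : dotmx w' u = 0.
  by rewrite linearBl linearZl_LR /= uu mulr1 subrr.
split=> //.
have {1 2}-> : w = w' + dotmx w u *: u by rewrite subrK.
rewrite hnormDd /=; first by rewrite (dnormZ (@dotmx C n)) /= uu mulr1.
by rewrite linearZr_LR /= E mulr0.
Qed.

Lemma bessel2 (C : numClosedFieldType) n (u v w : 'rV[C]_n) :
  dotmx u u = 1 -> dotmx v v = 1 -> dotmx u v = 0 ->
  `|dotmx w u| ^+ 2 + `|dotmx w v| ^+ 2 <= dotmx w w.
Proof.
move=> uu vv uv; have [_ ->] := @dotmx_residual _ _ u w uu.
set w' := w - _; have [_ ->] := @dotmx_residual _ _ v w' vv.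
have -> : dotmx w' v = dotmx w v.
  by rewrite linearBl linearZl_LR /= uv mulr0 subr0.
by rewrite [leRHS]addrC lerD2l lerDr (dnorm_ge0 (@dotmx C n)).
Qed.

Lemma parseval (C : numClosedFieldType) n (v : 'I_n -> 'rV[C]_n) (w : 'rV[C]_n) :
  (forall i j, dotmx (v i) (v j) = (i == j)%:R) ->
  \sum_i `|dotmx w (v i)| ^+ 2 = dotmx w w.
Proof.
move=> vE; pose U := \matrix_i v i.
(* [U] is square, so this also yields [U ^t* *m U = 1%:M], which is inserted between [w] and its
   adjoint. *)
have UU : U *m U ^t* = 1%:M.
  by apply/eqP/row_unitarymxP => i j; rewrite !rowK.
rewrite dotmxE -[X in X *m _]mulmx1 -(mulmx1C UU) mulmxA -mulmxA.
rewrite mxE; apply: eq_bigr => i _.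
have e : dotmx w (v i) = (w *m U ^t*) 0 i.
  rewrite dotmxE !mxE; apply: eq_bigr => j _; by rewrite !mxE.
rewrite normCK e; congr (_ * _).
rewrite !mxE rmorph_sum; apply: eq_bigr => j _.
by rewrite !mxE rmorphM /= conjCK mulrC.
Qed.

(** * Choice of a direction *)

Lemma window_polynomial (R : realType) n (a b e : R) :
  0 <= a <= b -> b < 1 -> 0 < e ->
  exists p : {poly R}, [/\ forall x, 0 <= x <= 1 -> 0 <= p.[x],
    forall x, a <= x <= b -> 1 <= p.[x] &
    moment (sphere_moment R n.+1) p
      <= (1 - a) ^+ n.+1 - (1 - b) ^+ n.+1 + e].
Proof.
move=> ab b1 e0.
(* The bound of [bernstein_window] as a polynomial in [h]; by continuity at 0 a small [h] loses less
   than [e]. *)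
pose q : {poly R} :=
  ((1 - a)%:P + 2 *: 'X) ^+ n.+1 - ((1 - b)%:P - 2 *: 'X) ^+ n.+1 + 'X.
have [d d0 qd] := poly_cont 0 q e0.
pose h := Num.min (d / 2) ((1 - b) / 2).
have h0 : 0 < h by rewrite lt_min !divr_gt0 ?subr_gt0.
have hd : h < d by rewrite (@le_lt_trans _ _ (d / 2)) ?ge_min ?lexx //; lra.
have hb : h <= (1 - b) / 2 by rewrite ge_min lexx orbT.
pose m := (Num.truncn (n.+2%:R / h + (h ^+ 3)^-1)).+1.
have m_gt : n.+2%:R / h + (h ^+ 3)^-1 < m%:R by exact: truncnS_gt.
have h3 : 0 < h ^+ 3 by rewrite exprn_gt0.
have [|||p [p1 p2 p3]] := @bernstein_window R n a b h m ab h0.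
- lra.
- rewrite -ler_pdivrMr // (le_trans _ (ltW m_gt)) // lerDl invr_ge0 ltW //.
- rewrite -ler_pdivrMr // div1r (le_trans _ (ltW m_gt)) // lerDr divr_ge0 //.
  exact: ltW.
exists p; split => //; apply: le_trans p3 _.
have := qd h; rewrite subr0 gtr0_norm // => /(_ hd) /ltW; rewrite ler_norml => /andP[_].
by rewrite /q !hornerE subr0; lra.
Qed.


Lemma dotmx_sum (C : numClosedFieldType) n (u v : 'rV[C]_n) :
  dotmx u v = \sum_i u 0 i * (v 0 i)^*.
Proof. by rewrite dotmxE mxE; apply: eq_bigr => i _; rewrite !mxE. Qed.

Lemma sqn_norm (R : rcfType) (z : R[i]) : (sqn z)%:C%C = `|z| ^+ 2.
Proof. by rewrite sqnE normCK. Qed.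

Lemma dotmx_sqn (R : rcfType) n (u : 'rV[R[i]]_n) :
  dotmx u u = (\sum_i sqn (u 0 i))%:C%C.
Proof.
by rewrite dotmx_sum rmorph_sum; apply: eq_bigr => i _; rewrite /= sqnE.
Qed.

Lemma sqn_conj (R : rcfType) (z : R[i]) : sqn z^* = sqn z.
Proof. by apply: complexI; rewrite !sqnE conjCK mulrC. Qed.

Lemma sqn_dotmx_le1 (R : rcfType) n (u v : 'rV[R[i]]_n) :
  dotmx u u = 1 -> dotmx v v = 1 -> sqn (dotmx u v) <= 1.
Proof.
move=> uu vv; have: `|dotmx u v| ^+ 2 <= dotmx u u.
  have [_ ->] := @dotmx_residual _ _ v u vv.
  by rewrite lerDr (dnorm_ge0 (@dotmx _ n)).
by rewrite uu -sqn_norm lecR.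
Qed.

Lemma direction_with_small_window (R : realType) n (V : finType)
    (v : V -> 'rV[R[i]]_n.+2) (a b e : R) :
  (0 < #|V|)%N -> (forall x, dotmx (v x) (v x) = 1) ->
  0 <= a <= b -> b < 1 -> 0 < e ->
  exists2 w, dotmx w w = 1 &
    #|[pred x | a <= sqn (dotmx w (v x)) <= b]|%:R
      <= #|V|%:R * ((1 - a) ^+ n.+1 - (1 - b) ^+ n.+1 + e).
Proof.
move=> V0 v1 ab b1 e0; set beta := _ - _.
have [|p [p_ge0 p_ge1 p_le]] := @window_polynomial R n a b (e / 2) ab b1.
  by rewrite divr_gt0.
(* If every unit [w] had too many vectors in its window, the sum of [p - (beta + e)] would be
   nonnegative at all of them, hence so would its moment; but the moment of [p] is at most
   [beta + e / 2]. *)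
apply: contrapT => noW.
have c1 x : \sum_i sqn ((v x 0 i)^*) = 1.
  by apply: complexI; rewrite -[RHS](v1 x) dotmx_sqn; under eq_bigr do rewrite sqn_conj.
have := @sphere_moment_ge0 R n.+1 V (fun=> p - (beta + e)%:P) (fun x i => (v x 0 i)^*).
have mE x q : moment (fun k => sphere_moment R n.+1 k *
    (\sum_i sqn ((v x 0 i)^*)) ^+ k) q = moment (sphere_moment R n.+1) q.
  by rewrite /moment; apply: eq_bigr => k _; rewrite c1 expr1n mulr1.
under eq_bigr => x _ do rewrite mE.
rewrite sumr_const /= => H.
suff : 0 <= moment (sphere_moment R n.+1) (p - (beta + e)%:P).
  rewrite raddfB /= -alg_polyC linearZ /= -(expr0 'X) momentXn.
  rewrite /sphere_moment addn0 muln1 divff ?natr_fact_neq0 // mulr1.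
  move: p_le; rewrite -/beta; lra.
rewrite -(@pmulrn_lge0 _ _ #|V|) //; apply: H => phi phi1.
pose w : 'rV[R[i]]_n.+2 := \row_i phi i.
have w1 : dotmx w w = 1.
  by rewrite dotmx_sqn; under eq_bigr do rewrite mxE; rewrite phi1.
have dE x : \sum_i phi i * (v x 0 i)^* = dotmx w (v x).
  by rewrite dotmx_sum; apply: eq_bigr => i _; rewrite mxE.
under eq_bigr => x _ do rewrite dE hornerD hornerN hornerC.
rewrite sumrB sumr_const subr_ge0 -[leLHS]mulr_natl.
apply: (@le_trans _ _ #|[pred x | a <= sqn (dotmx w (v x)) <= b]|%:R).
  by rewrite leNgt; apply/negP => /ltW le_w; apply: noW; exists w.
rewrite -sum1_card natr_sum big_mkcond; apply: ler_sum => x _.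
rewrite inE /=; case: ifP => xab; first exact: p_ge1.
by rewrite p_ge0 // sqn_ge0 sqn_dotmx_le1.
Qed.

(** * The orthogonality graph *)

Lemma q_s_le (V : finType) (g : rel V) (T A : {set V}) :
  max_clique_hitting g T -> A \subset T -> independent g A ->
  (q_s g <= #|T| - #|A|)%N.
Proof.
move=> hitT sAT indA; rewrite /q_s -minEnat -leEnat.
apply: le_trans (bigmin_le_cond _ _ hitT) _.
by apply: (@bigmin_le_cond _ _ _ _ A); rewrite sAT.
Qed.

Lemma clique_number_le_card (V : finType) (g : rel V) :
  (clique_number g <= #|V|)%N.
Proof. by apply/bigmax_leqP => C _; exact: max_card. Qed.

(** Shows that orthogonality depends on the projectors alone, so an edge can be read off from any
    representatives. *)
Lemma mxtrace_projector (R : realType) d (u v : 'rV[R[i]]_d) :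
  \tr (projector u *m projector v) = `|dotmx u v| ^+ 2.
Proof.
rewrite /projector -mulmxA mxtrace_mulC !mulmxA -(mulmxA (u *m v ^t*)).
rewrite normCK trace_mx11 mxE.
rewrite big_ord1 -!dotmxE; congr (_ * _).
by rewrite hermC expr0 mul1r.
Qed.

Lemma orthogonality_graph_dotmx (R : realType) d (S : {fset 'rV[R[i]]_d})
    (P Q : projectors S) u v :
  fsval P = projector u -> fsval Q = projector v ->
  orthogonality_graph S P Q -> dotmx u v = 0.
Proof.
move=> Pu Qv /existsP[psi1 /existsP[psi2 /and3P[/eqP P1 /eqP Q2 /eqP dot0]]].
have := mxtrace_projector R d u v; rewrite -Pu -Qv P1 Q2 mxtrace_projector dot0.
by rewrite normr0 expr0n => /esym/eqP; rewrite sqrf_eq0 normr_eq0 => /eqP.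
Qed.

Lemma projectors_repr (R : realType) d (S : {fset 'rV[R[i]]_d}) :
  exists v : projectors S -> 'rV[R[i]]_d,
    forall P, v P \in S /\ fsval P = projector (v P).
Proof.
suff /choice[v vE] : forall P : projectors S,
    exists u, u \in S /\ fsval P = projector u by exists v.
by move=> P; have /imfsetP[psi /= psiS ->] := fsvalP P; exists psi.
Qed.

Lemma q_dim1 (R : realType) (S : {fset 'rV[R[i]]_1}) :
  (forall psi, psi \in S -> dotmx psi psi = 1) ->
  clique_number (orthogonality_graph S) = 1%N ->
  q (orthogonality_graph S) R = 0.
Proof.
move=> S_unit S_basis; have [v vE] := projectors_repr _ _ S.
have /eqP q0 : q_s (orthogonality_graph S) == 0%N.
  rewrite -leqn0 -[leqRHS](subnn #|[set: projectors S]|); apply: q_s_le => //.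
    apply/forallP=> C; apply/implyP=> _; apply/implyP=> /eqP C1.
    by rewrite setTI -card_gt0 C1 S_basis.
  apply/forallP=> P; apply/implyP=> _; apply/forallP=> Q; apply/implyP=> _.
  apply/implyP=> /eqP[]; apply: val_inj => /=.
  have E (X : projectors S) : fsval X = 1%:M.
    have [vS ->] := vE X; rewrite [LHS]mx11_scalar; congr (_%:M).
    rewrite -(S_unit _ vS) dotmx_sum big_ord1 mxE big_ord1 !mxE mulrC.
    by [].
  by rewrite !E.
by rewrite /q q0 mul0r.
Qed.

Lemma orthonormal_hits_threshold (R : rcfType) n (v : 'I_n.+1 -> 'rV[R[i]]_n.+1)
    (w : 'rV[R[i]]_n.+1) :
  (forall i j, dotmx (v i) (v j) = (i == j)%:R) -> dotmx w w = 1 ->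
  exists i, n.+1%:R^-1 <= sqn (dotmx w (v i)).
Proof.
move=> v1 w1; apply/existsP; rewrite -[X in is_true X]negbK negb_exists.
apply/negP => /forallP small.
have sum1 : \sum_i sqn (dotmx w (v i)) = 1.
  apply: complexI; rewrite rmorph_sum -[RHS]w1 -(parseval _ _ _ w v1).
  by apply: eq_bigr => i _ /=; rewrite sqn_norm.
have : \sum_(i < n.+1) sqn (dotmx w (v i)) < \sum_(i < n.+1) n.+1%:R^-1.
  apply: ltr_sum => [|i _]; first by apply/hasP; exists ord0; rewrite ?mem_index_enum.
  by rewrite ltNge small.
by rewrite sum1 sumr_const card_ord -[ltRHS]mulr_natr mulVf ?pnatr_eq0 // ltxx.
Qed.

(** A clique of size equal to the dimension is an orthonormal basis, so Parseval applies to it. *)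
Lemma max_clique_hitting_threshold (R : realType) n (S : {fset 'rV[R[i]]_n.+1})
    (v : projectors S -> 'rV[R[i]]_n.+1) (w : 'rV[R[i]]_n.+1) :
  clique_number (orthogonality_graph S) = n.+1 ->
  (forall P, fsval P = projector (v P)) -> (forall P, dotmx (v P) (v P) = 1) ->
  dotmx w w = 1 ->
  max_clique_hitting (orthogonality_graph S)
    [set P | n.+1%:R^-1 <= sqn (dotmx w (v P))].
Proof.
move=> S_basis vE v1 w1; apply/forallP=> C; apply/implyP=> /maxsetp cliqueC.
apply/implyP=> /eqP; rewrite S_basis => cardC.
pose f (i : 'I_n.+1) := enum_val (cast_ord (esym cardC) i).
have [|i fi] := @orthonormal_hits_threshold R n (v \o f) w _ w1; last first.
  by apply/set0Pn; exists (f i); rewrite !inE fi enum_valP.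
move=> i j /=; case: eqVneq => [->|neq_ij]; first by rewrite v1.
apply: (@orthogonality_graph_dotmx _ _ S (f i) (f j)) => //.
have /forallP/(_ (f i))/implyP/(_ (enum_valP _)) := cliqueC.
move=> /forallP/(_ (f j))/implyP/(_ (enum_valP _))/implyP; apply.
by apply: contra neq_ij => /eqP/enum_val_inj/cast_ord_inj ->.
Qed.

Lemma independent_threshold (R : realType) n (S : {fset 'rV[R[i]]_n})
    (v : projectors S -> 'rV[R[i]]_n) (w : 'rV[R[i]]_n) :
  (forall P, fsval P = projector (v P)) -> (forall P, dotmx (v P) (v P) = 1) ->
  dotmx w w = 1 ->
  independent (orthogonality_graph S) [set P | 2^-1 < sqn (dotmx w (v P))].
Proof.
move=> vE v1 w1; apply/forallP=> P; apply/implyP; rewrite inE => bigP.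
apply/forallP=> Q; apply/implyP; rewrite inE => bigQ; apply/implyP => _.
apply/negP => /(@orthogonality_graph_dotmx _ _ _ _ _ _ _ (vE P) (vE Q)) PQ.
have := bessel2 _ _ _ _ w (v1 P) (v1 Q) PQ.
rewrite w1 -!sqn_norm -rmorphD lecR; lra.
Qed.

Theorem theorem1 (R : realType) (d : nat) (S : {fset 'rV[R[i]]_d})
    (d_gt0 : (0 < d)%N)
    (S_unit : forall psi, psi \in S -> dotmx psi psi = 1)
    (S_basis : clique_number (orthogonality_graph S) = d) :
  q (orthogonality_graph S) R
    <= (1 - d%:R^-1) ^+ d.-1 - (2 ^+ d.-1)^-1.
Proof.
case: d => [//|[|n]] in S d_gt0 S_unit S_basis *.
  (* For [d = 1] the threshold 1/d exceeds 1/2 and there is no window; both sides are 0. *)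
  by rewrite q_dim1 // !expr0 invr1 subrr.
have [v vE] := projectors_repr _ _ S.
have v1 P : dotmx (v P) (v P) = 1 by apply: S_unit; have [] := vE P.
have {}vE P : fsval P = projector (v P) by have [] := vE P.
have V0 : (0 < #|{: projectors S}|)%N.
  by rewrite (leq_trans _ (clique_number_le_card _ (orthogonality_graph S))) // S_basis.
(* The direction [w] depends on [e], but [q] does not, so the slack can be removed at the end. *)
apply/ler_addgt0Pr => e e0.
have half0 : 0 <= (n.+2%:R^-1 : R) <= 2^-1.
  by rewrite invr_ge0 ler0n lef_pV2 ?posrE // ler_nat.
have [|w w1 few] := direction_with_small_window _ _ _ v _ 2^-1 e V0 v1 half0 _ e0.
  lra.
pose T := [set P : projectors S | n.+2%:R^-1 <= sqn (dotmx w (v P))].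
pose A := [set P : projectors S | 2^-1 < sqn (dotmx w (v P))].
have sAT : A \subset T.
  apply/subsetP=> P; rewrite !inE => /ltW; apply: le_trans.
  by case/andP: half0.
have qsTA : (q_s (orthogonality_graph S) <= #|T :\: A|)%N.
  rewrite cardsD (setIidPr sAT); apply: q_s_le => //.
    exact: max_clique_hitting_threshold.
  exact: independent_threshold.
rewrite /q ler_pdivrMr ?ltr0n // mulrC.
have -> : 2 ^+ n.+1 = (2^-1)^-1 ^+ n.+1 :> R by rewrite invrK.
rewrite exprVn invrK [X in _ - X ^+ _ + _](_ : _ = 1 - 2^-1); last by field.
apply: le_trans few; rewrite ler_nat (leq_trans qsTA) //.
rewrite subset_leq_card //.
by apply/subsetP=> P; rewrite !inE -leNgt andbC.
Qed.
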